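(* Let $0\le k<L$. For each $\ell=k,\dots,L$ let $\zeta_\ell\in\Theta_\ell$ be a representation of white noise in $\Theta_\ell$, with associated coefficient vector $\boldsymbol{\zeta}_\ell\sim\mathcal N(0,W_\ell^{-1})$, and suppose that the random vectors $\boldsymbol{\zeta}_k,\dots,\boldsymbol{\zeta}_L$ are independent. Then the level-$k$ function $$\zeta'_k=\zeta_L+\sum_{\ell=k}^{L-1}(I-\mathcal Q_{\ell+1})\,\zeta_\ell$$ is a representation of white noise in $\Theta_k$; that is, the coefficient vector of $\zeta'_k$ in the basis of $\Theta_k$ has distribution $\mathcal N(0,W_k^{-1})$.
   Context: Let $D\subset\mathbb R^d$, $d=2$ or $3$, be a bounded spatial domain, and let $(\cdot,\cdot)$ denote the $L^2(D)$ inner product. Let $\mathcal T_0$ be the finest triangulation of $D$ and $\mathcal T_1,\dots,\mathcal T_L$ a hierarchy of successively coarser triangulations, $\mathcal T_L$ being the coarsest. For $\ell=0,\dots,L$, $\Theta_\ell\subset L^2(D)$ is the finite-dimensional space of functions piecewise constant on the elements of $\mathcal T_\ell$. The triangulations are nested, so $\Theta_L\subset\Theta_{L-1}\subset\dots\subset\Theta_0$. Each $\Theta_\ell$ carries an $L^2$-orthogonal basis $\{\chi_\tau\}_{\tau\in\mathcal T_\ell}$ of piecewise constants ($\chi_\tau$ is a nonzero constant on the element $\tau$ and vanishes outside $\tau$). Its mass matrix is $W_\ell=\big((\chi_{\tau_i},\chi_{\tau_j})\big)_{\tau_i,\tau_j\in\mathcal T_\ell}$, which is diagonal and positive definite. The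 coefficient vector of $v\in\Theta_\ell$ is the vector of its coordinates in this basis. $\mathcal Q_\ell:L^2(D)\to\Theta_\ell$ is the $L^2$-orthogonal projection, and $I$ is the identity. White noise $\zeta$ on $D$ is the generalized Gaussian random field with $\langle\zeta,v\rangle\sim\mathcal N(0,\|v\|_{L^2(D)}^2)$ for all $v\in L^2(D)$ (so $\mathbb E[\langle\zeta,v\rangle\langle\zeta,w\rangle]=(v,w)$). A random element $\zeta_\ell$ of $\Theta_\ell$ is called a representation of white noise in $\Theta_\ell$ if the Gaussian vector $\big((\zeta_\ell,\chi_\tau)\big)_{\tau\in\mathcal T_\ell}$ has mean $0$ and covariance matrix $W_\ell$; equivalently, its coefficient vector $\boldsymbol{\zeta}_\ell$ has distribution $\mathcal N(0,W_\ell^{-1})$. *)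

(* Defs.v *)
From HB Require Import structures.
From mathcomp Require Import all_boot all_order all_algebra.
From mathcomp Require Import all_classical all_reals all_analysis.

Set Implicit Arguments.
Unset Strict Implicit.
Unset Printing Implicit Defensive.

Import Order.TTheory GRing.Theory Num.Theory.
Import numFieldNormedType.Exports.

Local Open Scope classical_set_scope.
Local Open Scope ring_scope.

(* Matrix spaces carry their Borel sigma-algebra. *)
HB.instance Definition _ (R : realType) (m n : nat) :=
  Measurable.copy 'M[R]_(m, n) (g_sigma_algebraType (@open 'M[R]_(m, n))).

(* Lebesgue measure on R^n, as an iterated product of one-dimensional Lebesgue
   measures on n-tuples, transported to the row vectors 'rV[R]_n. *)
Section lebesgue_tuple.
Context {R : realType}.
Local Notation RM := (measurableTypeR R).

Definition tuple_cons (n : nat) (x : RM * n.-tuple RM) : n.+1.-tuple RM :=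
  [tuple of x.1 :: x.2].

Lemma measurable_tuple_cons (n : nat) :
  measurable_fun [set: RM * n.-tuple RM] (@tuple_cons n).
Proof. exact: measurable_cons. Qed.

Section step.
Context (n : nat) (mu : {sigma_finite_measure set (n.-tuple RM) -> \bar R}).

Definition lebesgue_cons : set (n.+1.-tuple RM) -> \bar R :=
  pushforward (lebesgue_measure \x mu)%E (@tuple_cons n).

Let lebesgue_cons0 : lebesgue_cons set0 = 0%E.
Proof. by rewrite /lebesgue_cons /pushforward preimage_set0 measure0. Qed.

Let lebesgue_cons_ge0 A : (0 <= lebesgue_cons A)%E.
Proof. by rewrite /lebesgue_cons /pushforward measure_ge0. Qed.

Let lebesgue_cons_sigma_additive : semi_sigma_additive lebesgue_cons.
Proof.
rewrite /lebesgue_cons.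
by apply: measure_semi_sigma_additive => //; exact: measurable_tuple_cons.
Qed.

HB.instance Definition _ := isMeasure.Build _ _ _ lebesgue_cons
  lebesgue_cons0 lebesgue_cons_ge0 lebesgue_cons_sigma_additive.

Lemma lebesgue_cons_sigma_finite : sigma_finite setT lebesgue_cons.
Proof.
have /sigma_finiteP[F [TF ndF Foo]] := sigma_finiteT (@lebesgue_measure R).
have /sigma_finiteP[G [TG ndG Goo]] := sigma_finiteT mu.
pose g (t : n.+1.-tuple RM) := (thead t, [tuple of behead t]).
have mg : measurable_fun setT g.
  by apply: measurable_fun_pair;
    [exact: measurable_tnth|exact: measurable_behead].
have gK : g \o @tuple_cons n = id.
  by apply/funext => -[x t]; congr (_, _); exact/val_inj.
exists (fun i => g @^-1` (F i `*` G i)).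
  apply/esym; rewrite -subTset => t _.
  have [[i _ Fi] [j _ Gj]] : (\bigcup_i F i) (g t).1 /\ (\bigcup_i G i) (g t).2.
    by rewrite -TF -TG.
  exists (maxn i j) => //; split.
    by move: Fi; exact/subsetPset/ndF/leq_maxl.
  by move: Gj; exact/subsetPset/ndG/leq_maxr.
move=> i; have [mF Fi] := Foo i; have [mG Gi] := Goo i; split.
  by rewrite -[X in measurable X]setTI; apply: mg => //; exact: measurableX.
rewrite /lebesgue_cons /pushforward (_ : _ @^-1` _ = F i `*` G i).
  by rewrite product_measure1E// lte_mul_pinfty// ge0_fin_numE.
by rewrite -comp_preimage gK.
Qed.

HB.instance Definition _ :=
  Measure_isSigmaFinite.Build _ _ _ lebesgue_cons lebesgue_cons_sigma_finite.

End step.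

Fixpoint lebesgue_tuple (n : nat) :
    {sigma_finite_measure set (n.-tuple RM) -> \bar R} :=
  match n with
  | 0 => \d_([tuple] : 0.-tuple RM)
  | n'.+1 => lebesgue_cons (lebesgue_tuple n')
  end.

End lebesgue_tuple.

Definition row_of_tuple {R : realType} (n : nat)
    (t : n.-tuple (measurableTypeR R)) : 'rV[R]_n :=
  \row_i tnth t i.

Lemma measurable_row_of_tuple (R : realType) (n : nat) :
  measurable_fun [set: n.-tuple (measurableTypeR R)] (@row_of_tuple R n).
Proof.
apply: (@measurability _ _ _ _ _ _ (@open 'rV[R]_n)) => // _ [U oU <-].
rewrite setTI.
pose box (q : 'rV[rat]_n * rat) : set 'rV[R]_n :=
  [set x | forall i, `|x ord0 i - ratr (q.1 ord0 i)| < ratr q.2].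
have -> : @row_of_tuple R n @^-1` U =
    \bigcup_(q in [set q | box q `<=` U]) (@row_of_tuple R n @^-1` box q).
  apply/seteqP; split=> [t Ut|t [q /= qU] /qU//].
  have /nbhs_ballP[e e0 eU] : nbhs (row_of_tuple t) U.
    by apply: open_nbhs_nbhs.
  have e20 : 0 < e / 2 by rewrite divr_gt0.
  have [r /itvP re] := rat_in_itvoo e20.
  have near i : exists q : rat, `|tnth t i - ratr q| < ratr r.
    have [|q /itvP qt] := @rat_in_itvoo _ (tnth t i - ratr r) (tnth t i + ratr r).
      by rewrite ltrBlDr -addrA ltrDl addr_gt0// re.
    exists q; rewrite distrC ltr_distl; apply/andP; split; by rewrite qt.
  have [q qP] := choice near.
  exists (\row_i q i, r) => /=; last by move=> i; rewrite !mxE.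
  move=> y yq; apply: eU; split=> // i j; rewrite (ord1 i).
  rewrite -ball_normE/= [X in `|X|](_ : _ =
      (tnth t j - ratr (q j)) - (y ord0 j - ratr (q j))); last first.
    by rewrite mxE opprB addrA subrK.
  rewrite (le_lt_trans (ler_normB _ _))// (splitr e) ltrD//.
    by rewrite (lt_trans (qP j))// re.
  by have := yq j; rewrite /= !mxE => /lt_trans; apply; rewrite re.
rewrite bigcup_mkcond; apply: countable_bigcupT_measurable => // q.
case: ifPn => // _.
rewrite (_ : _ @^-1` _ = \bigcap_(i in [set: 'I_n])
    ((fun t : n.-tuple (measurableTypeR R) => tnth t i) @^-1`
      ball (ratr (q.1 ord0 i) : R) (ratr q.2))); last first.
  apply/seteqP; split=> t /= tq i; first by move=> _; have := tq i;
    rewrite mxE /ball/= distrC.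
  by have := tq i I; rewrite mxE /ball/= distrC.
apply: fin_bigcap_measurable => // i _.
rewrite -[X in measurable X]setTI; apply: measurable_tnth => //.
rewrite ball_itv; exact: measurable_itv.
Qed.

Section lebesgue_rV.
Context {R : realType} (n : nat).

Definition lebesgue_rV : set 'rV[R]_n -> \bar R :=
  pushforward (lebesgue_tuple n) (@row_of_tuple R n).

Let lebesgue_rV0 : lebesgue_rV set0 = 0%E.
Proof. by rewrite /lebesgue_rV /pushforward preimage_set0 measure0. Qed.

Let lebesgue_rV_ge0 A : (0 <= lebesgue_rV A)%E.
Proof. by rewrite /lebesgue_rV /pushforward measure_ge0. Qed.

Let lebesgue_rV_sigma_additive : semi_sigma_additive lebesgue_rV.
Proof.
rewrite /lebesgue_rV.
by apply: measure_semi_sigma_additive => //; exact: measurable_row_of_tuple.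
Qed.

HB.instance Definition _ := isMeasure.Build _ _ _ lebesgue_rV
  lebesgue_rV0 lebesgue_rV_ge0 lebesgue_rV_sigma_additive.

End lebesgue_rV.
Arguments lebesgue_rV {R} n.

Section bounded_domain.
Context {R : realType} {d : nat}.

Record domain := Domain {
  domain_set :> set 'rV[R]_d;
  domain_open : open domain_set;
  domain_connected : connected domain_set;
  domain_nonempty : domain_set !=set0;
  domain_bounded : bounded_set domain_set }.

Lemma domain_measurable (D : domain) : measurable (D : set 'rV[R]_d).
Proof. by apply: sub_sigma_algebra; exact: domain_open. Qed.

(* Lebesgue measure on D, seen as a measure on R^d that ignores the complement
   of D; accordingly "a.e." and integrals with respect to it are over D. *)
Definition domain_measure (D : domain) : {measure set 'rV[R]_d -> \bar R} :=
  mrestr (lebesgue_rV d) (domain_measurable D).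

(* The elements are genuine square-integrable functions, not classes; equality
   in L^2(D) is equality a.e. for domain_measure D. *)
Definition L2 (D : domain) := LfunType (domain_measure D) (lee1n 2).

Definition L2_inner (D : domain) (v w : 'rV[R]_d -> R) : R :=
  \int[domain_measure D]_x (v x * w x).

(* A triangulation in the sense of finite element theory: closed elements with
   nonempty interior and negligible boundary, pairwise disjoint interiors, and
   union the closure of D. Simplices are a particular case; hexahedra, curved
   elements and agglomerates of simplices are also allowed. *)
Record triangulation (D : domain) := Triangulation {
  ncell : nat;
  cell : 'I_ncell -> set 'rV[R]_d;
  cell_closed : forall i, closed (cell i);
  cell_interior : forall i, (cell i)° !=set0;
  cell_boundary : forall i, lebesgue_rV d (cell i `\` (cell i)°) = 0%E;
  cell_disjoint : forall i j, i != j -> (cell i)° `&` (cell j)° = set0;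
  cell_cover : \bigcup_i cell i = closure D }.

Arguments cell {D} t i _.

Definition refines (D : domain) (S T : triangulation D) : Prop :=
  forall i : 'I_(ncell S), exists j : 'I_(ncell T), cell S i `<=` cell T j.

Section pw_constant.
Context (D : domain) (T : triangulation D).

Definition Theta : set (L2 D) := [set v | exists a : 'I_(ncell T) -> R,
  forall i, {ae domain_measure D, forall x, cell T i x -> v x = a i}].

Definition chi (c : 'I_(ncell T) -> R) (i : 'I_(ncell T)) : 'rV[R]_d -> R :=
  fun x => c i * \1_(cell T i) x.

Definition mass_matrix (c : 'I_(ncell T) -> R) : 'M[R]_(ncell T) :=
  \matrix_(i, j) L2_inner D (chi c i) (chi c j).

(* The coordinates of v in the basis chi c; they exist and are unique when
   v is in Theta and all the constants c i are nonzero. *)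
Definition coef_vec (c : 'I_(ncell T) -> R) (v : L2 D) : 'rV[R]_(ncell T) :=
  xget 0 [set a : 'rV[R]_(ncell T) |
    {ae domain_measure D, forall x, v x = \sum_i a ord0 i * chi c i x}].

Definition pairings (c : 'I_(ncell T) -> R) (v : L2 D) : 'rV[R]_(ncell T) :=
  \row_i L2_inner D v (chi c i).

(* The L^2-orthogonal projection onto Theta; as elements of L2 D are functions,
   the projection is unique up to equality a.e., and a version is chosen. *)
Definition L2_proj (v : L2 D) : L2 D :=
  xget 0 [set q | Theta q /\ forall w, Theta w -> L2_inner D (v - q : L2 D) w = 0].

End pw_constant.
End bounded_domain.
Arguments domain : clear implicits.

Section gaussian.
Context {R : realType} {dO : measure_display} {Omega : measurableType dO}.
Variable P : probability Omega R.

(* The normal law with mean m and variance s2 >= 0; it is a Dirac mass_matrix when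
   s2 = 0. The second argument of normal_prob is the standard deviation. *)
Definition normal_law (m s2 : R) : set R -> \bar R :=
  if s2 == 0 then \d_m else normal_prob m (Num.sqrt s2).

Definition gaussian_vector (n : nat) (X : Omega -> 'rV[R]_n) : Prop :=
  (forall i, measurable_fun setT (fun w => X w ord0 i)) /\
  forall a : 'rV[R]_n, exists m s2 : R, 0 <= s2 /\
    forall B : set R, measurable B ->
      P ((fun w => \sum_i a ord0 i * X w ord0 i) @^-1` B) = normal_law m s2 B.

Definition has_normal_law (n : nat) (X : Omega -> 'rV[R]_n)
    (m : 'rV[R]_n) (S : 'M[R]_n) : Prop :=
  [/\ gaussian_vector X,
      forall i, 'E_P[fun w => X w ord0 i]%E = (m ord0 i)%:E &
      forall i j, covariance P (fun w => X w ord0 i) (fun w => X w ord0 j)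
                  = (S i j)%:E].

(* Mutual independence of the random vectors X l, k <= l <= L. Since B l may
   be the whole space, the product rule for subfamilies is included. *)
Definition independent_vectors (k L : nat) (n : nat -> nat)
    (X : forall l, Omega -> 'rV[R]_(n l)) : Prop :=
  forall B : forall l, set 'rV[R]_(n l), (forall l, measurable (B l)) ->
    P (\bigcap_(l in [set l | (k <= l <= L)%N]) (X l @^-1` B l)) =
    (\prod_(k <= l < L.+1) P (X l @^-1` B l))%E.

Definition white_noise_repr (d : nat) (D : domain R d) (T : triangulation D)
    (c : 'I_(ncell T) -> R) (zeta : Omega -> L2 D) : Prop :=
  (forall w, Theta T (zeta w)) /\
  has_normal_law (fun w => pairings c (zeta w)) 0 (mass_matrix c).

End gaussian.

(* Main.v *)
From HB Require Import structures.
Require Import Defs.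
From mathcomp Require Import all_boot all_order all_algebra.
From mathcomp Require Import all_classical all_reals all_analysis.
From mathcomp Require Import measurable_realfun.
From mathcomp Require Import ring lra.

Set Implicit Arguments.
Unset Strict Implicit.
Unset Printing Implicit Defensive.

Import Order.TTheory GRing.Theory Num.Theory.
Import numFieldNormedType.Exports.

Local Open Scope classical_set_scope.
Local Open Scope ring_scope.

(** Write [M l q] for the matrix of L2(D) inner products between the basis
    functions of levels [l] and [q], so that [W l = M l l] is the mass matrix
    of level [l].  An element of Theta_l with pairing vector [p] has
    coefficients [p *m invmx (W l)] ([coef_vecE]), and hence pairings
    [p *m invmx (W l) *m M l q] with the basis of any level [q]
    ([pairings_cross]).  Applied to the coarse basis functions, which belong
    to Theta_l because the meshes are nested, this gives
    [M l.+1 l *m invmx (W l) *m M l q = M l.+1 q] ([cross_mass_trans]); and the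
    projection onto a level keeps the pairings with that level
    ([pairings_proj]).

    With [X l] the coefficient vector of zeta_l, the pairings of zeta'_k with
    the level-[k] basis are therefore the sum of the vectors [X l *m A l], with
    [A l = M l k - M l l.+1 *m invmx (W l.+1) *m M l.+1 k] for [l < L] and
    [A L = M L k].  The terms are independent with mean zero, and the law of
    [X l] is N(0, invmx (W l)), so the sum is Gaussian and its covariance is
    the sum of the matrices [(A l)^T *m invmx (W l) *m A l].  The identity above
    turns this term into [G l - G l.+1] for [l < L] and into [G L] for
    [l = L], where [G l = M k l *m invmx (W l) *m M l k].  The sum telescopes
    to [G k = W k], which says that zeta'_k is a representation of white noise.

    Two ingredients come from measure theory.  The sum of independent
    Gaussian vectors is Gaussian ([has_normal_law_sum_mulmx]): on linear forms
    this is the convolution of two normal densities ([normal_prob_convolution])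
    together with the fact that a partial sum of independent variables is
    independent of the next one ([partial_sum_independent]).  The mass matrix
    is diagonal and invertible ([mass_matrix_diag], [mass_matrix_unit]): almost
    every point of D lies in exactly one cell ([ae_unique_cell]), and every
    cell has positive finite measure. *)

(** * Convolution of normal laws *)

Section normal_convolution.
Context {R : realType}.
Implicit Types (m s x y z : R) (A : set R).
Local Notation mu := (@lebesgue_measure R).
Local Notation RM := (measurableTypeR R).

Lemma lebesgue_measure_translate (a : R) (A : set RM) :
  measurable A -> mu ((fun x => x + a) @^-1` A) = mu A.
Proof.
have mt : measurable_fun setT
    ((fun x => x + a) : RM -> RM).
  exact: measurable_funD.
move=> mA; apply/esym; rewrite -[RHS]/(pushforward mu _ A).
apply: lebesgue_measure_unique => // _ [[u v]] _ <-.
rewrite -[RHS]/(mu ((fun x => x + a) @^-1` `]u, v])).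
rewrite (_ : _ @^-1` _ = `]u - a, v - a]%classic); last first.
  by apply/seteqP; split => x /=; rewrite !in_itv/= ltrBlDr lerBrDr.
rewrite !lebesgue_measure_itv/= !lte_fin ltrD2r.
by case: ifP => // _; rewrite -!EFinB; congr EFin; lra.
Qed.

Lemma ge0_integral_translate (a : R) (f : R -> \bar R) :
  measurable_fun setT f -> (forall x, 0 <= f x)%E ->
  (\int[mu]_x f (x + a)%R = \int[mu]_x f x)%E.
Proof.
move=> mf f0.
pose t : RM -> RM := fun x => x + a.
have mt : measurable_fun setT t by exact: measurable_funD.
transitivity (\int[pushforward mu t]_x f x)%E.
  by rewrite ge0_integral_pushforward.
apply: eq_measure_integral => B mB _; exact: lebesgue_measure_translate.
Qed.

(** The density is the Radon-Nikodym derivative of the law.  The bound by 1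
    makes [f] integrable. *)
Lemma ge0_integral_normal_prob m s (f : R -> \bar R) :
  measurable_fun setT f -> (forall x, 0 <= f x <= 1)%E ->
  (\int[normal_prob m s]_x f x = \int[mu]_x (f x * (normal_pdf m s x)%:E))%E.
Proof.
move=> mf f01.
have fi : (normal_prob m s).-integrable setT f.
  apply: (@le_integrable _ _ _ _ _ measurableT _ (cst 1%E)) => //.
  - move=> x _; have /andP[f0 f1] := f01 x.
    by rewrite gee0_abs//= normr1.
  - exact: finite_measure_integrable_cst.
rewrite -(Radon_Nikodym_change_of_variables (normal_prob_dominates m s))//=.
apply: ae_eq_integral => //.
- apply: emeasurable_funM => //; apply: (measurable_int mu).
  apply: Radon_Nikodym_integrable; exact: normal_prob_dominates.
- apply: emeasurable_funM => //=; apply/measurableT_comp => //=.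
  exact: measurable_normal_pdf.
- apply: ae_eqe_mul2l => /=.
  rewrite Radon_NikodymE//=; first exact: normal_prob_dominates.
  move=> abmu.
  case: cid => /= h [h1 h2 h3].
  apply: integral_ae_eq => //=.
  + by apply/measurableT_comp => //; exact: measurable_normal_pdf.
  + by move=> E E01 mE; rewrite -h3.
Qed.

(** Completing the square: as a function of [x], the product of the two
    densities is a normal density with standard deviation [s1 * s2 / s],
    times a factor that is the density of the sum at [z].  Integrating in [x]
    then needs only that normal densities have total mass 1. *)
Lemma normal_pdf_convolution m1 s1 m2 s2 x z : s1 != 0 -> s2 != 0 ->
  let s := Num.sqrt (s1 ^+ 2 + s2 ^+ 2) in
  normal_pdf m1 s1 x * normal_pdf m2 s2 (z - x) =
  normal_pdf (m1 + m2) s z *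
  normal_pdf ((s2 ^+ 2 * m1 + s1 ^+ 2 * (z - m2)) / s ^+ 2) (s1 * s2 / s) x.
Proof.
move=> s10 s20 s.
have s1p : 0 < s1 ^+ 2 by rewrite exprn_even_gt0.
have s2p : 0 < s2 ^+ 2 by rewrite exprn_even_gt0.
have sE : s ^+ 2 = s1 ^+ 2 + s2 ^+ 2 by rewrite sqr_sqrtr// ltW// addr_gt0.
have sp : 0 < s by rewrite sqrtr_gt0 addr_gt0.
have s0 : s != 0 by rewrite gt_eqF.
have t0 : s1 * s2 / s != 0 by rewrite !mulf_neq0// invr_eq0.
have peakE : (s1 ^+ 2 * pi *+ 2) * (s2 ^+ 2 * pi *+ 2) =
    (s ^+ 2 * pi *+ 2) * ((s1 * s2 / s) ^+ 2 * pi *+ 2).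
  by rewrite !mulr2n; field.
rewrite !normal_pdfE//= mulrACA [RHS]mulrACA; congr (_ * _).
  by rewrite /normal_peak -!invfM -!sqrtrM ?peakE//
    mulrn_wge0// mulr_ge0 ?sqr_ge0 ?pi_ge0.
rewrite /normal_fun -!expRD; congr expR.
rewrite !mulr2n expr_div_n exprMn sE.
field.
by rewrite !gt_eqF// !addr_gt0// exprn_even_gt0//= mulf_neq0.
Qed.

(** By translation invariance the mass of the section at [x] is the integral
    of the second density at [z - x] over [z] in [A]; exchanging the integrals
    brings the product of densities into the form of
    [normal_pdf_convolution]. *)
Lemma normal_prob_convolution m1 s1 m2 s2 A : s1 != 0 -> s2 != 0 -> measurable A ->
  (normal_prob m1 s1 \x normal_prob m2 s2)%E ((fun p => p.1 + p.2)%R @^-1` A) =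
  normal_prob (m1 + m2) (Num.sqrt (s1 ^+ 2 + s2 ^+ 2)) A.
Proof.
move=> s10 s20 mA; set s := Num.sqrt _.
set f := fun z => (\1_A z)%:E : \bar R.
have mf : measurable_fun setT f.
  by apply/measurable_EFinP; exact: measurable_indic.
have f01 z : (0 <= f z <= 1)%E.
  by rewrite !lee_fin /f indicE; case: (_ \in _); rewrite /= ?lexx ler01.
have f0 z : (0 <= f z)%E by have /andP[] := f01 z.
have mp1 : measurable_fun setT (normal_pdf m1 s1) by exact: measurable_normal_pdf.
have mp2 : measurable_fun setT (normal_pdf m2 s2) by exact: measurable_normal_pdf.
have mzx : measurable_fun setT (fun p : RM * RM => p.2 - p.1).
  by apply: measurable_funB; [exact: measurable_snd|exact: measurable_fst].
have mxz : measurable_fun setT (fun p : RM * RM => p.1 + p.2).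
  by apply: measurable_funD; [exact: measurable_fst|exact: measurable_snd].
pose h x := (\int[mu]_z (f z * (normal_pdf m2 s2 (z - x)%R)%:E))%E.
have hE x : normal_prob m2 s2 (xsection ((fun p => p.1 + p.2)%R @^-1` A) x) = h x.
  rewrite /normal_prob integral_mkcond /h -(ge0_integral_translate x).
  - apply: eq_integral => y _; rewrite addrK /f patchE indicE.
    rewrite (addrC y) mem_xsection.
    have -> : ((x, y) \in (fun p : R * R => p.1 + p.2) @^-1` A) = (x + y \in A).
      by apply/idP/idP => /set_mem ?; apply/mem_set.
    by case: ifP; rewrite ?mul1e ?mul0e.
  - apply: emeasurable_funM => //; apply/measurable_EFinP.
    by apply: measurableT_comp => //; exact: measurable_funB.
  - by move=> z; rewrite mule_ge0// lee_fin normal_pdf_ge0.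
rewrite /product_measure1/=.
under eq_integral do rewrite /= hE.
have mS : measurable ((fun p : RM * RM => p.1 + p.2) @^-1` A).
  by rewrite -[X in measurable X]setTI; exact: mxz.
rewrite ge0_integral_normal_prob; last 2 first.
  have := @measurable_fun_xsection _ _ _ _ _ (normal_prob m2 s2) _ mS.
  by apply: eq_measurable_fun => x _ /=; rewrite hE.
  move=> x; rewrite -hE measure_ge0/= probability_le1//.
  exact: measurable_xsection.
pose F (p : RM * RM) :=
  (f p.2 * (normal_pdf m1 s1 p.1 * normal_pdf m2 s2 (p.2 - p.1))%:E)%E.
have F0 p : (0 <= F p)%E.
  by rewrite mule_ge0// lee_fin mulr_ge0// normal_pdf_ge0.
have mF : measurable_fun setT F.
  apply: emeasurable_funM.
    by apply: measurableT_comp => //; exact: measurable_snd.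
  apply/measurable_EFinP; apply: measurable_funM.
    by apply: measurableT_comp => //; exact: measurable_fst.
  by apply: measurableT_comp.
transitivity (\int[mu]_x \int[mu]_z F (x, z))%E.
  apply: eq_integral => x _; rewrite /h muleC -ge0_integralZl//.
  - by apply: eq_integral => z _; rewrite /F/= EFinM muleCA.
  - apply: emeasurable_funM => //; apply/measurable_EFinP.
    by apply: measurableT_comp => //; exact: measurable_funB.
  - by move=> z _; rewrite mule_ge0// lee_fin normal_pdf_ge0.
  - by rewrite lee_fin normal_pdf_ge0.
rewrite (fubini_tonelli F mF F0) /= /normal_prob [RHS]integral_mkcond.
apply: eq_integral => z _; rewrite /F/=.
under eq_integral do rewrite (normal_pdf_convolution m1 m2 _ z s10 s20) EFinM muleA.
rewrite ge0_integralZl//.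
- rewrite integral_normal_pdf mule1 patchE /f indicE.
  by case: ifP; rewrite ?mul1e ?mul0e.
- by apply/measurable_EFinP; exact: measurable_normal_pdf.
- by move=> x _; rewrite lee_fin normal_pdf_ge0.
- by rewrite mule_ge0// lee_fin normal_pdf_ge0.
Qed.

End normal_convolution.

(** * Integrals of products of square-integrable functions *)

Section L2_product.
Context {d : measure_display} {T : measurableType d} {R : realType}.
Variable mu : {measure set T -> \bar R}.
Implicit Types f g h : T -> R.

(** The unnormalised L2 product with respect to any measure: it is the L2(D)
    inner product when [mu] is the measure of the domain, and the second-order
    moment of centred variables when [mu] is a probability. *)
Definition inner f g : R := \int[mu]_x (f x * g x).

Lemma innerC f g : inner f g = inner g f.
Proof. by apply: eq_Rintegral => x _; rewrite mulrC. Qed.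

Lemma Lfun2M_integrable f g : f \in Lfun mu 2%:E -> g \in Lfun mu 2%:E ->
  mu.-integrable setT (EFin \o (f \* g)).
Proof. by move=> f2 g2; apply/Lfun1_integrable; exact: Lfun2_mul_Lfun1. Qed.

Lemma innerDl f g h : f \in Lfun mu 2%:E -> g \in Lfun mu 2%:E ->
  h \in Lfun mu 2%:E -> inner (fun x => f x + g x) h = inner f h + inner g h.
Proof.
move=> f2 g2 h2; rewrite /inner.
rewrite -RintegralD//; [|exact: Lfun2M_integrable..].
by apply: eq_Rintegral => x _; rewrite mulrDl.
Qed.

Lemma innerBl f g h : f \in Lfun mu 2%:E -> g \in Lfun mu 2%:E ->
  h \in Lfun mu 2%:E -> inner (fun x => f x - g x) h = inner f h - inner g h.
Proof.
move=> f2 g2 h2; rewrite /inner.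
rewrite -RintegralB//; [|exact: Lfun2M_integrable..].
by apply: eq_Rintegral => x _; rewrite mulrBl.
Qed.

Lemma innerZl a f h : f \in Lfun mu 2%:E -> h \in Lfun mu 2%:E ->
  inner (fun x => a * f x) h = a * inner f h.
Proof.
move=> f2 h2; rewrite /inner -RintegralZl//; last exact: Lfun2M_integrable.
by apply: eq_Rintegral => x _; rewrite mulrA.
Qed.

Lemma Lfun2_sum (I : Type) (r : seq I) (Q : pred I) (f : I -> T -> R) :
  (forall i, Q i -> f i \in Lfun mu 2%:E) ->
  (fun x => \sum_(i <- r | Q i) f i x) \in Lfun mu 2%:E.
Proof.
move=> f2; have [l2_0 l2_D] := @Lfun_addr_closed _ T R mu 2%:E (lee1n 2).
elim: r => [|i r IH].
  rewrite (_ : (fun _ => _) = 0)//.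
  by apply/funext => x; rewrite big_nil.
have [Qi|Qi] := boolP (Q i).
  rewrite (_ : (fun _ => _) = f i + (fun x => \sum_(j <- r | Q j) f j x)).
    by apply: l2_D => //; exact: f2.
  by apply/funext => x; rewrite big_cons Qi.
rewrite (_ : (fun _ => _) = (fun x => \sum_(j <- r | Q j) f j x))//.
by apply/funext => x; rewrite big_cons (negbTE Qi).
Qed.

Lemma Lfun2Z a f : f \in Lfun mu 2%:E -> (fun x => a * f x) \in Lfun mu 2%:E.
Proof.
move=> f2; rewrite (_ : (fun _ => _) = a \o* f); last first.
  by apply/funext => x /=; rewrite mulrC.
by apply: Lfun_scale => //; rewrite ler1n.
Qed.

Lemma inner_suml (I : Type) (r : seq I) (Q : pred I) (f : I -> T -> R) h :
  (forall i, Q i -> f i \in Lfun mu 2%:E) -> h \in Lfun mu 2%:E ->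
  inner (fun x => \sum_(i <- r | Q i) f i x) h = \sum_(i <- r | Q i) inner (f i) h.
Proof.
move=> f2 h2; elim: r => [|i r IH].
  rewrite big_nil /inner; under eq_Rintegral do rewrite big_nil mul0r.
  by rewrite Rintegral_cst// mul0r.
rewrite big_cons; have [Qi|Qi] := boolP (Q i); last first.
  by rewrite -IH; apply: eq_Rintegral => x _; rewrite big_cons (negbTE Qi).
rewrite -IH -innerDl//; [|exact: f2|exact: Lfun2_sum].
by apply: eq_Rintegral => x _; rewrite big_cons Qi.
Qed.

Lemma inner_sumr (I : Type) (r : seq I) (Q : pred I) (f : I -> T -> R) h :
  (forall i, Q i -> f i \in Lfun mu 2%:E) -> h \in Lfun mu 2%:E ->
  inner h (fun x => \sum_(i <- r | Q i) f i x) = \sum_(i <- r | Q i) inner h (f i).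
Proof.
by move=> f2 h2; rewrite innerC inner_suml//; apply: eq_bigr => i _; rewrite innerC.
Qed.

Lemma sqr_integrable_Lfun2 f : measurable_fun setT f ->
  (\int[mu]_x (f x ^+ 2)%:E < +oo)%E -> f \in Lfun mu 2%:E.
Proof.
move=> mf fy; rewrite inE; apply/andP; split; rewrite inE//=.
rewrite /finite_norm unlock /Lnorm poweR_lty//.
under eq_integral do rewrite /= powR_mulrn// real_normK ?num_real//.
by [].
Qed.

End L2_product.

(** * Normal random variables *)

Section normal_variables.
Context {R : realType} {dO : measure_display} {Omega : measurableType dO}.
Variable P : probability Omega R.
Implicit Types X Y : Omega -> R.
Local Notation RM := (measurableTypeR R).

Lemma measurable_preimageT d2 (T2 : measurableType d2) (f : Omega -> T2)
    (B : set T2) : measurable_fun setT f -> measurable B -> measurable (f @^-1` B).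
Proof. by move=> mf mB; rewrite -[X in measurable X]setTI; exact: mf. Qed.

Definition normal_rv X := exists m s2 : R, 0 <= s2 /\
  forall B : set R, measurable B -> P (X @^-1` B) = normal_law m s2 B.

Lemma normal_law_shift (a m v : R) (B : set R) : measurable B -> 0 <= v ->
  normal_law m v ((fun y => a + y) @^-1` B) = normal_law (a + m) v B.
Proof.
move=> mB v0; rewrite /normal_law; case: ifPn => [_|vn0].
  by rewrite !diracE; congr (_%:R%:E); apply/idP/idP => /set_mem ?; apply/mem_set.
have sn0 : Num.sqrt v != 0 by rewrite gt_eqF// sqrtr_gt0 lt_neqAle eq_sym vn0.
rewrite /normal_prob [RHS]integral_mkcond -(ge0_integral_translate a).
- rewrite integral_mkcond; apply: eq_integral => y _; rewrite !patchE.
  rewrite !normal_pdfE// /normal_fun.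
  have -> : y + a - (a + m) = y - m by ring.
  have -> : (y \in (fun y => a + y) @^-1` B) = (y + a \in B).
    by rewrite addrC; apply/idP/idP => /set_mem ?; apply/mem_set.
  by [].
- apply/(measurable_restrictT _ _).1 => //; apply/measurable_EFinP.
  by apply: measurable_funTS; exact: measurable_normal_pdf.
- by move=> x; rewrite patchE; case: ifP => // _; rewrite lee_fin normal_pdf_ge0.
Qed.

(** A variable with a Dirac law is almost surely constant, so adding it
    translates the law of [Y]. *)
Lemma normal_rv_shift X Y m v (m0 : R) : measurable_fun setT X ->
  measurable_fun setT Y ->
  (forall B : set R, measurable B -> P (X @^-1` B) = \d_m0 B) -> 0 <= v ->
  (forall B : set R, measurable B -> P (Y @^-1` B) = normal_law m v B) ->
  normal_rv (fun w => X w + Y w).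
Proof.
move=> mX mY X0 v_ge0 YN; exists (m0 + m), v; split=> // B mB.
rewrite -normal_law_shift// -YN; last first.
  rewrite -[X in measurable X]setTI.
  by apply: (measurable_funD (measurable_cst m0) (@measurable_id _ R setT)).
(* Off the null event X <> m0, the sum equals m0 + Y. *)
have XN0 : P (X @^-1` (~` [set m0])) = 0%E.
  rewrite X0; last by apply: measurableC; exact: measurable_set1.
  by rewrite diracE memNset// => /(_ erefl).
have mN : measurable (X @^-1` (~` [set m0])).
  by apply: measurable_preimageT => //; apply: measurableC; exact: measurable_set1.
have mYB : measurable (Y @^-1` ((fun y => m0 + y) @^-1` B)).
  rewrite -comp_preimage; apply: measurable_preimageT => //=.
  by apply: measurable_funD.
have mXY : measurable ((fun w => X w + Y w) @^-1` B).
  by apply: measurable_preimageT => //; exact: measurable_funD.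
have e (A : set Omega) : measurable A -> P A = P (A `\` X @^-1` (~` [set m0])).
  move=> mA; rewrite measureD//; last by rewrite -ge0_fin_numE// fin_num_measure.
  rewrite [X in (_ - X)%E](_ : _ = 0%E) ?sube0//.
  by apply/eqP; rewrite eq_le measure_ge0 andbT -XN0 le_measure//
    inE//; exact: measurableI.
rewrite e// [RHS]e//; congr (P _); apply/seteqP; split => w /= [Bw /contrapT Xw].
  by split; [rewrite -Xw|apply].
by split; [rewrite Xw|apply].
Qed.

Definition independent_pair X Y := forall A B : set R, measurable A ->
  measurable B -> P (X @^-1` A `&` Y @^-1` B) = (P (X @^-1` A) * P (Y @^-1` B))%E.

(** The law of the pair is the product of the two laws.  Degenerate laws have
    no density and are treated as translations. *)
Lemma normal_rvD X Y : measurable_fun setT X -> measurable_fun setT Y ->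
  independent_pair X Y -> normal_rv X -> normal_rv Y ->
  normal_rv (fun w => X w + Y w).
Proof.
move=> mX mY XY [m1 [v1 [v10 NX]]] [m2 [v2 [v20 NY]]].
have [v1E|v1n0] := eqVneq v1 0.
  apply: (@normal_rv_shift X Y m2 v2 m1) => // B mB.
  by rewrite NX// /normal_law v1E eqxx.
have [v2E|v2n0] := eqVneq v2 0.
  rewrite (_ : (fun _ => _) = (fun w => Y w + X w)); last first.
    by apply/funext => w; rewrite addrC.
  apply: (@normal_rv_shift Y X m1 v1 m2) => // B mB.
  by rewrite NY// /normal_law v2E eqxx.
exists (m1 + m2), (v1 + v2); split; first by rewrite addr_ge0.
move=> B mB.
have s0 v : 0 <= v -> v != 0 -> Num.sqrt v != 0.
  by move=> ? ?; rewrite gt_eqF// sqrtr_gt0 lt_neqAle eq_sym; apply/andP.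
have -> : normal_law (m1 + m2) (v1 + v2) B =
    normal_prob (m1 + m2) (Num.sqrt (Num.sqrt v1 ^+ 2 + Num.sqrt v2 ^+ 2)) B.
  by rewrite /normal_law !sqr_sqrtr// paddr_eq0// (negbTE v1n0).
rewrite -normal_prob_convolution ?s0//.
have mXY : measurable_fun setT (fun w => (X w, Y w) : RM * RM).
  exact: measurable_fun_pair.
have mxz : measurable_fun setT (fun p : RM * RM => p.1 + p.2).
  by apply: measurable_funD; [exact: measurable_fst|exact: measurable_snd].
rewrite -[LHS]/(pushforward P (fun w => (X w, Y w) : RM * RM)
  ((fun p => p.1 + p.2) @^-1` B)).
apply/esym; apply: product_measure_unique => //.
- move=> A C mA mC; rewrite -[LHS]/(P (X @^-1` A `&` Y @^-1` C)) XY// NX// NY//.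
  by rewrite /normal_law (negbTE v1n0) (negbTE v2n0).
- by rewrite -[X in measurable X]setTI; exact: mxz.
Qed.

End normal_variables.

(** * Independence *)

Section independence.
Context {R : realType} {dO : measure_display} {Omega : measurableType dO}.
Variable P : probability Omega R.
Local Notation RM := (measurableTypeR R).

(** Conditionally on [E], the law of the pair agrees with the product of the
    marginals on rectangles, hence everywhere.  Keeping [E] in the statement
    lets independence from further variables be carried along an induction. *)
Lemma joint_law (X Y : {mfun Omega >-> RM}) (E : set Omega) : measurable E ->
  (forall A B : set RM, measurable A -> measurable B ->
    P (X @^-1` A `&` (Y @^-1` B `&` E)) = (P (X @^-1` A) * (P (Y @^-1` B) * P E))%E) ->
  forall S : set (RM * RM), measurable S ->
  P ((fun w => (X w, Y w)) @^-1` S `&` E) =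
  ((distribution P X \x distribution P Y)%E S * P E)%E.
Proof.
move=> mE XYE S mS.
have mXY : measurable_fun setT (fun w => (X w, Y w)).
  exact: measurable_fun_pair.
have mXYS (C : set (RM * RM)) : measurable C ->
    measurable ((fun w => (X w, Y w)) @^-1` C).
  by move=> mC; exact: (measurable_preimageT mXY mC).
(* The conditional probability given E only makes sense when P E > 0. *)
have [PE0|PE0] := eqVneq (P E) 0%E.
  rewrite PE0 mule0; apply/eqP; rewrite eq_le measure_ge0 andbT -PE0.
  apply: le_measure; rewrite ?inE//.
  by apply: measurableI => //; exact: mXYS.
have PEfin : P E \is a fin_num by rewrite fin_num_measure.
have p0 : 0 < fine (P E).
  by rewrite fine_gt0// lt_neqAle eq_sym PE0 measure_ge0/= ltey_eq PEfin.
have [r rE] : exists r : {nonneg R}, r%:num = (fine (P E))^-1.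
  have r0 : 0 <= (fine (P E))^-1 by rewrite invr_ge0 ltW.
  by exists (NngNum r0).
have PEE : P E = (fine (P E))%:E by rewrite fineK.
have -> : (distribution P X \x distribution P Y)%E S =
    pushforward (mscale r (mrestr P mE)) (fun w => (X w, Y w)) S.
  apply: product_measure_unique => // A B mA mB.
  rewrite -[LHS]/(r%:num%:E * P ((X @^-1` A `&` Y @^-1` B) `&` E))%E.
  rewrite -setIA XYE//= muleCA [X in (_ * X)%E]muleCA.
  by rewrite PEE -EFinM rE mulVf ?gt_eqF// mule1.
rewrite -[X in (X * _)%E]/(r%:num%:E * P ((fun w => (X w, Y w)) @^-1` S `&` E))%E.
by rewrite muleAC PEE -EFinM rE mulVf ?gt_eqF// mul1e.
Qed.

Lemma independent_pair_joint (X Y : {mfun Omega >-> RM}) :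
  independent_pair P X Y -> forall S : set (RM * RM), measurable S ->
  P ((fun w => (X w, Y w)) @^-1` S) = (distribution P X \x distribution P Y)%E S.
Proof.
move=> XY S mS; rewrite -[LHS](congr1 P (setIT _)) joint_law//.
  by rewrite probability_setT mule1.
by move=> A B mA mB; rewrite setIT XY// probability_setT mule1.
Qed.

Lemma independent_pair_addE (X Y : Omega -> R) (E : set Omega) :
  measurable_fun setT X -> measurable_fun setT Y -> measurable E ->
  independent_pair P X Y ->
  (forall A B : set RM, measurable A -> measurable B ->
    P (X @^-1` A `&` (Y @^-1` B `&` E)) = (P (X @^-1` A) * (P (Y @^-1` B) * P E))%E) ->
  forall A : set R, measurable A ->
  P ((fun w => X w + Y w) @^-1` A `&` E) =
  (P ((fun w => (X w + Y w)%R) @^-1` A) * P E)%E.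
Proof.
move=> mX mY mE XY XYE A mA.
pose X' : {mfun Omega >-> RM} := HB.pack X (isMeasurableFun.Build _ _ _ RM X mX).
pose Y' : {mfun Omega >-> RM} := HB.pack Y (isMeasurableFun.Build _ _ _ RM Y mY).
have mS : measurable ((fun p : RM * RM => p.1 + p.2) @^-1` A).
  rewrite -[X in measurable X]setTI.
  have : measurable_fun setT (fun p : RM * RM => p.1 + p.2).
    by apply: measurable_funD; [exact: measurable_fst|exact: measurable_snd].
  exact.
have JE := @joint_law X' Y' E mE XYE _ mS.
rewrite -(@independent_pair_joint X' Y' XY _ mS) in JE.
exact: JE.
Qed.

Definition independent_rvs (k L : nat) (Y : nat -> Omega -> R) :=
  forall B : nat -> set R, (forall l, measurable (B l)) ->
    P (\bigcap_(l in [set l | (k <= l <= L)%N]) (Y l @^-1` B l)) =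
    (\prod_(k <= l < L.+1) P (Y l @^-1` B l))%E.

Lemma measurable_sum_nat (k n : nat) (Y : nat -> Omega -> R) :
  (forall l, (k <= l < n)%N -> measurable_fun setT (Y l)) ->
  measurable_fun setT (fun w => \sum_(k <= l < n) Y l w).
Proof.
elim: n => [|n IH] mY.
  by under eq_fun do rewrite big_geq//; exact: measurable_cst.
have [nk|kn] := ltnP n k.
  by under eq_fun do rewrite big_geq//; exact: measurable_cst.
under eq_fun do rewrite big_nat_recr//=.
apply: measurable_funD; last by apply: mY; rewrite kn leqnn.
by apply: IH => l /andP[kl ln]; apply: mY; rewrite kl ltnW.
Qed.

Lemma independent_pair_head (n L : nat) (S : Omega -> R) (Y : nat -> Omega -> R) :
  (n <= L)%N ->
  (forall (A : set R) (B : nat -> set R), measurable A ->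
    (forall l, measurable (B l)) ->
    P (S @^-1` A `&` \bigcap_(l in [set l | (n <= l <= L)%N]) (Y l @^-1` B l)) =
    (P (S @^-1` A) * \prod_(n <= l < L.+1) P (Y l @^-1` B l))%E) ->
  independent_pair P S (Y n).
Proof.
move=> nL H C D mC mD; pose B l := if l == n then D else setT.
have mB l : measurable (B l) by rewrite /B; case: ifP.
have := H C B mC mB.
rewrite big_ltn// {2}/B eqxx big1_seq ?mule1; last first.
  move=> l; rewrite mem_index_iota => /and3P[_ nl _].
  by rewrite /B gtn_eqF// preimage_setT probability_setT.
move=> <-; congr (P (_ `&` _)); apply/seteqP; split => w.
  by move=> wD l _; rewrite /B /=; case: ifP => // /eqP ->.
by move=> /(_ n); rewrite /B /= eqxx leqnn; exact.
Qed.

(** The induction moves one variable at a time from the tail into the sum: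
    the event [E] of [independent_pair_addE] is the part of the tail that stays
    outside. *)
Lemma partial_sum_independent (k L : nat) (Y : nat -> Omega -> R) :
  (forall l, (k <= l <= L)%N -> measurable_fun setT (Y l)) -> independent_rvs k L Y ->
  forall n, (k <= n <= L.+1)%N -> forall (A : set R) (B : nat -> set R),
  measurable A -> (forall l, measurable (B l)) ->
  P ((fun w => \sum_(k <= l < n) Y l w) @^-1` A `&`
     \bigcap_(l in [set l | (n <= l <= L)%N]) (Y l @^-1` B l)) =
  (P ((fun w => (\sum_(k <= l < n) Y l w)%R) @^-1` A) *
   \prod_(n <= l < L.+1) P (Y l @^-1` B l))%E.
Proof.
move=> mY YI.
have base (A : set R) (B : nat -> set R) : (forall l, measurable (B l)) ->
    P ((fun w => \sum_(k <= l < k) Y l w) @^-1` A `&`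
       \bigcap_(l in [set l | (k <= l <= L)%N]) (Y l @^-1` B l)) =
    (P ((fun w => (\sum_(k <= l < k) Y l w)%R) @^-1` A) *
     \prod_(k <= l < L.+1) P (Y l @^-1` B l))%E.
  move=> mB; have [A0|A0] := pselect (A 0).
    rewrite (_ : _ @^-1` A = setT) ?setTI ?probability_setT ?mul1e ?YI//.
    by apply/seteqP; split=> // w _ /=; rewrite big_geq.
  rewrite (_ : _ @^-1` A = set0) ?set0I ?measure0 ?mul0e//.
  by apply/seteqP; split=> // w /=; rewrite big_geq.
move=> n /andP[]; elim: n => [|n IH] kn nL A B mA mB.
  by move: kn; rewrite leqn0 => /eqP <-; exact: base.
move: kn; rewrite leq_eqVlt => /predU1P[<-|]; first exact: base.
rewrite ltnS => kn; have {}IH := IH kn (ltnW nL).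
set S := (fun w => \sum_(k <= l < n) Y l w) in IH *.
have mS : measurable_fun setT S.
  apply: measurable_sum_nat => l /andP[kl ln]; apply: mY.
  by rewrite kl -ltnS (leq_trans ln)// ltnW.
(* Replacing the n-th event by C makes the induction hypothesis speak of the
   pair of the partial sum and Y n, with the rest of the tail as E. *)
pose upd C l := if l == n then C else B l.
have mupd C l : measurable C -> measurable (upd C l).
  by move=> mC; rewrite /upd; case: ifP.
pose E := \bigcap_(l in [set l | (n.+1 <= l <= L)%N]) (Y l @^-1` B l).
have mE : measurable E.
  apply: bigcap_measurableType => l /andP[nl lL].
  by apply: measurable_preimageT => //; apply: mY; rewrite lL (leq_trans kn)// ltnW.
have capE C : \bigcap_(l in [set l | (n <= l <= L)%N]) (Y l @^-1` upd C l) =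
    Y n @^-1` C `&` E.
  apply/seteqP; split => w.
    move=> H; split; first by have := H n; rewrite /upd /= eqxx leqnn; exact.
    by move=> l /= /andP[nl lL];
      have := H l; rewrite /upd /= gtn_eqF// lL ltnW//; exact.
  move=> [wC wE] l /= /andP[]; rewrite leq_eqVlt => /predU1P[<- _|nl lL].
    by rewrite /upd eqxx.
  by rewrite /upd gtn_eqF//; apply: wE; rewrite /= nl.
have prodE C : (\prod_(n <= l < L.+1) P (Y l @^-1` upd C l) =
    P (Y n @^-1` C) * \prod_(n.+1 <= l < L.+1) P (Y l @^-1` B l))%E.
  rewrite big_ltn// {1}/upd eqxx; congr (_ * _)%E.
  by apply: eq_big_nat => l /andP[nl _]; rewrite /upd gtn_eqF.
have PE : P E = (\prod_(n.+1 <= l < L.+1) P (Y l @^-1` B l))%E.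
  have := IH setT (upd setT) measurableT (fun l => mupd _ l measurableT).
  by rewrite capE prodE !preimage_setT !setTI probability_setT !mul1e.
have H C D : measurable C -> measurable D ->
    P (S @^-1` C `&` (Y n @^-1` D `&` E)) =
    (P (S @^-1` C) * (P (Y n @^-1` D) * P E))%E.
  move=> mC mD; rewrite -capE IH//; last by move=> l; exact: mupd.
  by rewrite prodE PE.
have SY := independent_pair_head (ltnSE nL) IH.
have -> : (fun w => \sum_(k <= l < n.+1) Y l w) = (fun w => S w + Y n w).
  by apply/funext => w; rewrite big_nat_recr.
by rewrite -PE independent_pair_addE//; apply: mY; rewrite kn.
Qed.

Lemma normal_rv_sum (k L : nat) (Y : nat -> Omega -> R) :
  (forall l, (k <= l <= L)%N -> measurable_fun setT (Y l)) ->
  independent_rvs k L Y -> (forall l, (k <= l <= L)%N -> normal_rv P (Y l)) ->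
  normal_rv P (fun w => \sum_(k <= l < L.+1) Y l w).
Proof.
move=> mY YI NY.
have normal0 : normal_rv P (fun=> 0 : R).
  exists 0, 0; split=> // B mB; rewrite /normal_law eqxx diracE preimage_cst.
  by case: ifP => _; rewrite ?probability_setT ?measure0.
suff H n : (n <= L.+1)%N -> normal_rv P (fun w => \sum_(k <= l < n) Y l w).
  exact: H.
elim: n => [_|n IH nL]; first by under eq_fun do rewrite big_geq//.
have [nk|kn] := ltnP n k; first by under eq_fun do rewrite big_geq//.
under eq_fun do rewrite big_nat_recr//=.
have knL : (k <= n <= L)%N by rewrite kn.
apply: normal_rvD.
- apply: measurable_sum_nat => l /andP[kl ln]; apply: mY.
  by rewrite kl -ltnS (leq_trans ln)// ltnW.
- exact: mY.
- apply: (independent_pair_head (ltnSE nL)) => A B mA mB.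
  by apply: partial_sum_independent => //; rewrite kn ltnW.
- by apply: IH; exact: ltnW.
- exact: NY.
Qed.

(** Fubini for the joint law, which is the product of the marginals. *)
Lemma independent_pair_inner (X Y : Omega -> R) :
  X \in Lfun P 2%:E -> Y \in Lfun P 2%:E -> independent_pair P X Y ->
  inner P X Y = inner P X (cst 1) * inner P Y (cst 1).
Proof.
move=> X2 Y2 XY.
have mX : measurable_fun setT X by move: X2 => /sub_Lfun_mfun; rewrite inE.
have mY : measurable_fun setT Y by move: Y2 => /sub_Lfun_mfun; rewrite inE.
pose X' : {mfun Omega >-> RM} := HB.pack X (isMeasurableFun.Build _ _ _ RM X mX).
pose Y' : {mfun Omega >-> RM} := HB.pack Y (isMeasurableFun.Build _ _ _ RM Y mY).
have XYJ := @independent_pair_joint X' Y' XY.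
have mXY : measurable_fun setT (fun w => (X' w, Y' w)).
  exact: measurable_fun_pair.
pose f (p : RM * RM) : \bar R := (p.1 * p.2)%:E.
have mf : measurable_fun setT f.
  apply/measurable_EFinP.
  by apply: measurable_funM; [exact: measurable_fst|exact: measurable_snd].
have Pfin : P setT \is a fin_num := fin_num_measure P _ measurableT.
have XYi : P.-integrable setT (f \o (fun w => (X' w, Y' w))).
  exact: (Lfun2M_integrable X2 Y2).
have Xi : P.-integrable setT (EFin \o X).
  by apply/Lfun1_integrable; exact: Lfun_subset12.
have Yi : P.-integrable setT (EFin \o Y).
  by apply/Lfun1_integrable; exact: Lfun_subset12.
have fi : (distribution P X' \x distribution P Y')%E.-integrable setT f.
  apply/integrableP; split => //.
  rewrite (@eq_measure_integral _ _ _ _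
    (pushforward P (fun w => (X' w, Y' w)))) //; last first.
    by move=> S mS _; exact/esym/XYJ.
  rewrite ge0_integral_pushforward//; last exact: measurableT_comp.
  by have /integrableP[_] := XYi.
rewrite {1}/inner /Rintegral.
have -> : (\int[P]_x (X x * Y x)%:E)%E =
    (\int[distribution P X' \x distribution P Y']_z f z)%E.
  rewrite (@eq_measure_integral _ _ _ _
    (pushforward P (fun w => (X' w, Y' w)))) //; last first.
    by move=> S mS _; exact/esym/XYJ.
  by rewrite integral_pushforward.
rewrite -integral12_prod_meas1// /fubini_F /f/=.
have distE (Z : {mfun Omega >-> RM}) : P.-integrable setT (EFin \o (Z : Omega -> R)) ->
    (distribution P Z).-integrable setT EFin /\
    (\int[distribution P Z]_x x%:E = (inner P Z (cst 1))%:E)%E.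
  move=> Zi; split; first exact: integrable_pushforward.
  rewrite integral_distribution// /inner /Rintegral fineK.
    by apply: eq_integral => x _; rewrite /= mulr1.
  rewrite (eq_integral (fun x => (Z x)%:E)); last first.
    by move=> x _; rewrite /= mulr1.
  exact: integrable_fin_num.
have [X'i XE] := distE X' Xi; have [Y'i YE] := distE Y' Yi.
rewrite (eq_integral (fun x : RM => (x : R)%:E * (inner P Y (cst 1))%:E))%E; last first.
  by move=> x _; rewrite -YE -integralZl.
by rewrite integralZr// XE.
Qed.

End independence.

(** * Gaussian vectors *)

Section normal_vectors.
Context {R : realType} {dO : measure_display} {Omega : measurableType dO}.
Variable P : probability Omega R.

Lemma covariance_inner (X Y : Omega -> R) : X \in Lfun P 2%:E -> Y \in Lfun P 2%:E ->
  'E_P[X]%E = 0%E -> 'E_P[Y]%E = 0%E -> covariance P X Y = (inner P X Y)%:E.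
Proof.
move=> X2 Y2 X0 Y0; rewrite unlock X0 Y0 /= unlock /inner /Rintegral fineK.
  by apply: eq_integral => w _; rewrite /GRing.mul/= !subr0.
exact: integrable_fin_num (Lfun2M_integrable X2 Y2).
Qed.

Lemma expectation_inner (X : Omega -> R) : X \in Lfun P 2%:E ->
  'E_P[X]%E = (inner P X (cst 1))%:E.
Proof.
move=> X2; have c2 : cst 1 \in Lfun P 2%:E by exact: Lfun_cst.
rewrite unlock /inner /Rintegral fineK.
  by apply: eq_integral => w _; rewrite mulr1.
exact: integrable_fin_num (Lfun2M_integrable X2 c2).
Qed.

(** For a centred vector, the finiteness of the variances already gives square
    integrability, and the covariances are plain L2 products. *)
Lemma has_normal_law0P n (X : Omega -> 'rV[R]_n) (S : 'M[R]_n) :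
  has_normal_law P X 0 S <->
  [/\ gaussian_vector P X,
      forall i, (fun w => X w ord0 i) \in Lfun P 2%:E,
      forall i, inner P (fun w => X w ord0 i) (cst 1) = 0 &
      forall i j, inner P (fun w => X w ord0 i) (fun w => X w ord0 j) = S i j].
Proof.
split=> [[gX EX CX]|[gX X2 EX CX]]; last first.
  split=> // [i|i j]; first by rewrite expectation_inner// EX mxE.
  by rewrite covariance_inner ?CX// expectation_inner// EX.
have X2 i : (fun w => X w ord0 i) \in Lfun P 2%:E.
  apply: sqr_integrable_Lfun2; first by have [] := gX.
  have := CX i i; rewrite unlock EX mxE /= unlock => H.
  suff -> : (\int[P]_w (X w ord0 i ^+ 2)%:E = (S i i)%:E)%E by rewrite ltry.
  by rewrite -H; apply: eq_integral => w _; rewrite /GRing.mul/= !subr0 expr2.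
have E0 i : 'E_P[fun w => X w ord0 i]%E = 0%E by rewrite EX mxE.
split=> // [i|i j].
  by apply: EFin_inj; rewrite -expectation_inner.
by apply: EFin_inj; rewrite -covariance_inner.
Qed.

Lemma linear_form_mulmx n p (a : 'rV[R]_p) (x : 'rV[R]_n) (A : 'M[R]_(n, p)) :
  \sum_i a ord0 i * (x *m A) ord0 i = \sum_j (a *m A^T) ord0 j * x ord0 j.
Proof.
under eq_bigr do rewrite mxE mulr_sumr; rewrite exchange_big /=.
apply: eq_bigr => j _; rewrite mxE mulr_suml.
by apply: eq_bigr => i _; rewrite mxE; ring.
Qed.

Lemma has_normal_law_mulmx n p (X : Omega -> 'rV[R]_n) (S : 'M[R]_n)
    (A : 'M[R]_(n, p)) : has_normal_law P X 0 S ->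
  has_normal_law P (fun w => X w *m A) 0 (A^T *m S *m A).
Proof.
move=> /has_normal_law0P[[mX gX] X2 EX CX].
have XA i : (fun w => (X w *m A) ord0 i) =
    (fun w => \sum_j A j i * X w ord0 j).
  by apply/funext => w; rewrite mxE; apply: eq_bigr => j _; rewrite mulrC.
have AX2 i j : (fun w => A j i * X w ord0 j) \in Lfun P 2%:E by exact: Lfun2Z.
have XA2 i : (fun w => (X w *m A) ord0 i) \in Lfun P 2%:E.
  by rewrite XA; exact: Lfun2_sum.
apply/has_normal_law0P; split => //.
- split=> [i|a].
    by rewrite XA; apply: measurable_sum => j /=;
      apply: measurable_funM => //; exact: mX.
  have [m [v [v0 H]]] := gX (a *m A^T).
  exists m, v; split=> // B mB.
  by under eq_fun do rewrite linear_form_mulmx; exact: H.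
- move=> i; rewrite XA inner_suml//; last exact: Lfun_cst.
  by rewrite big1// => j _; rewrite innerZl ?Lfun_cst// EX mulr0.
- move=> i q; rewrite !XA inner_suml//; last by rewrite -XA.
  under eq_bigr do rewrite innerZl ?inner_sumr -?XA//.
  rewrite !mxE; under [RHS]eq_bigr do rewrite mxE mulr_suml.
  rewrite [RHS]exchange_big/=; apply: eq_bigr => j _; rewrite mulr_sumr.
  apply: eq_bigr => r _; rewrite innerC innerZl// innerC CX mxE; ring.
Qed.

Lemma measurable_coord n (i : 'I_n) :
  measurable_fun setT (fun x : 'rV[R]_n => x ord0 i).
Proof.
apply: (measurability _ (RGenOInfty.measurableE R)) => _ [_ [y ->] <-].
rewrite setTI; apply: sub_sigma_algebra.
have /continuousP := @coord_continuous R 1 n ord0 i.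
by apply; exact: rray_open.
Qed.

Lemma measurable_linear_form n (a : 'rV[R]_n) :
  measurable_fun setT (fun x : 'rV[R]_n => \sum_i a ord0 i * x ord0 i).
Proof.
apply: measurable_sum => i /=.
by apply: measurable_funM => //; exact: measurable_coord.
Qed.

(** Linear forms are Borel, so independence of vectors of different dimensions
    reduces to independence of real variables. *)
Lemma independent_linear_forms (k L : nat) (n : nat -> nat)
    (X : forall l, Omega -> 'rV[R]_(n l)) (a : forall l, 'rV[R]_(n l)) :
  independent_vectors P k L X ->
  independent_rvs P k L (fun l w => \sum_i a l ord0 i * X l w ord0 i).
Proof.
move=> XI B mB.
apply: (XI (fun l => (fun x : 'rV[R]_(n l) => \sum_i a l ord0 i * x ord0 i) @^-1` B l)).
move=> l; rewrite -[X in measurable X]setTI.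
exact: measurable_linear_form.
Qed.

Lemma independent_rvs_pair (k L : nat) (Y : nat -> Omega -> R) l q :
  (k <= l <= L)%N -> (k <= q <= L)%N -> l != q -> independent_rvs P k L Y ->
  independent_pair P (Y l) (Y q).
Proof.
move=> lin qin lq YI A B mA mB.
pose C r := if r == l then A else if r == q then B else setT.
have mC r : measurable (C r) by rewrite /C; do 2 case: ifP => // _.
have := YI C mC.
have -> : \bigcap_(r in [set r | (k <= r <= L)%N]) (Y r @^-1` C r) =
    Y l @^-1` A `&` Y q @^-1` B.
  apply/seteqP; split => [w Hw|w [wA wB] r _]; last first.
    by rewrite /C /=; case: eqP => [->//|_]; case: eqP => [->|].
  split; first by have := Hw l lin; rewrite /C /= eqxx.
  by have := Hw q qin; rewrite /C /= eqxx (eq_sym q) (negbTE lq).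
move=> ->; rewrite (bigD1_seq l) ?mem_index_iota ?iota_uniq//=.
rewrite big_mkcond (bigD1_seq q) ?mem_index_iota ?iota_uniq//=.
rewrite {1 2}/C eqxx (eq_sym q) lq (negbTE lq) eqxx big1_seq ?mule1//.
move=> r /andP[rq _]; rewrite /C (negbTE rq); case: eqVneq => //= _.
by rewrite preimage_setT probability_setT.
Qed.

(** Independence enters through linear forms: it gives normality of every
    linear combination of the sum, and the vanishing of the covariances
    between different terms. *)
Lemma has_normal_law_sum (k L p : nat) (V : nat -> Omega -> 'rV[R]_p)
    (S : nat -> 'M[R]_p) :
  (forall l, (k <= l <= L)%N -> has_normal_law P (V l) 0 (S l)) ->
  (forall a : nat -> 'rV[R]_p,
    independent_rvs P k L (fun l w => \sum_i a l ord0 i * V l w ord0 i)) ->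
  has_normal_law P (fun w => \sum_(k <= l < L.+1) V l w) 0
    (\sum_(k <= l < L.+1) S l).
Proof.
move=> VN VI.
have V2 l i : (k <= l < L.+1)%N -> (fun w => V l w ord0 i) \in Lfun P 2%:E.
  by move=> /VN/has_normal_law0P[].
have V0 l i : (k <= l < L.+1)%N -> inner P (fun w => V l w ord0 i) (cst 1) = 0.
  by move=> /VN/has_normal_law0P[].
have natE (F : nat -> R) : \sum_(k <= l < L.+1) F l =
    \sum_(k <= l < L.+1 | (k <= l < L.+1)%N) F l.
  by rewrite big_nat_cond; apply: eq_bigl => l; rewrite andbT.
have sumE i : (fun w => (\sum_(k <= l < L.+1) V l w) ord0 i) =
    (fun w => \sum_(k <= l < L.+1 | (k <= l < L.+1)%N) V l w ord0 i).
  by apply/funext => w; rewrite summxE natE.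
have cross l q i j : (k <= l < L.+1)%N -> (k <= q < L.+1)%N -> l != q ->
    inner P (fun w => V l w ord0 i) (fun w => V q w ord0 j) = 0.
  move=> lin qin lq.
  pose a r : 'rV[R]_p := if r == l then delta_mx ord0 i else delta_mx ord0 j.
  have form (i' : 'I_p) (x : 'rV[R]_p) :
      \sum_j' (delta_mx ord0 i' : 'rV[R]_p) ord0 j' * x ord0 j' = x ord0 i'.
    rewrite (bigD1 i')//= mxE !eqxx mul1r big1 ?addr0// => j' ji.
    by rewrite mxE (negbTE ji) andbF mul0r.
  have := independent_rvs_pair lin qin lq (VI a).
  rewrite /a eqxx (eq_sym q) (negbTE lq).
  under eq_fun do rewrite form.
  under [X in independent_pair _ _ X]eq_fun do rewrite form.
  by move=> /independent_pair_inner ->; rewrite ?V2// V0// mul0r.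
apply/has_normal_law0P; split => //.
- split=> [i|a].
    rewrite sumE; under eq_fun do rewrite -natE.
    apply: measurable_sum_nat => l lin.
    by have [[mV _] _ _] := VN _ lin; exact: mV.
  have -> : (fun w => \sum_i a ord0 i * (\sum_(k <= l < L.+1) V l w) ord0 i) =
      (fun w => \sum_(k <= l < L.+1) \sum_i a ord0 i * V l w ord0 i).
    apply/funext => w; rewrite exchange_big; apply: eq_bigr => i _.
    by rewrite summxE mulr_sumr.
  apply: normal_rv_sum => // [l lin|l lin].
    have [[mV _] _ _] := VN _ lin.
    apply: measurable_sum => i /=; apply: measurable_funM => //; exact: mV.
  by have [[_ gV] _ _] := VN _ lin; exact: gV.
- by move=> i; rewrite sumE; apply: Lfun2_sum => l lin; exact: V2.
- move=> i; rewrite sumE inner_suml//; last 2 first.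
    by move=> l lin; exact: V2.
    exact: Lfun_cst.
  by rewrite big1// => l lin; rewrite V0.
- move=> i j; rewrite !sumE inner_suml; last 2 first.
    by move=> l lin; exact: V2.
    by apply: Lfun2_sum => l lin; exact: V2.
  rewrite summxE natE; apply: eq_bigr => l lin.
  rewrite inner_sumr; last 2 first.
    by move=> q qin; exact: V2.
    exact: V2.
  rewrite -natE (bigD1_seq l) ?mem_index_iota ?iota_uniq//=.
  rewrite big1_seq ?addr0.
    by have /has_normal_law0P[_ _ _ ->] := VN _ lin.
  by move=> q; rewrite mem_index_iota => /andP[ql qin]; rewrite cross// eq_sym.
Qed.

Lemma has_normal_law_sum_mulmx (k L p : nat) (n : nat -> nat)
    (X : forall l, Omega -> 'rV[R]_(n l)) (S : forall l, 'M[R]_(n l))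
    (A : forall l, 'M[R]_(n l, p)) :
  (forall l, (k <= l <= L)%N -> has_normal_law P (X l) 0 (S l)) ->
  independent_vectors P k L X ->
  has_normal_law P (fun w => \sum_(k <= l < L.+1) X l w *m A l) 0
    (\sum_(k <= l < L.+1) (A l)^T *m S l *m A l).
Proof.
move=> XN XI; apply: has_normal_law_sum => [l lin|a].
  exact: has_normal_law_mulmx (XN l lin).
have := independent_linear_forms (fun l => a l *m (A l)^T) XI.
congr (independent_rvs P k L _); apply/funext => l; apply/funext => w.
by rewrite linear_form_mulmx.
Qed.

End normal_vectors.

(** * Lebesgue measure of cubes *)

Section lebesgue_cubes.
Context {R : realType}.
Local Notation RM := (measurableTypeR R).

(** The centre [a] is a sequence indexed by [nat], so that dropping the first
    coordinate in the induction is a shift of the sequence. *)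
Lemma lebesgue_tuple_cube n (a : nat -> R) (r : R) : 0 <= r ->
  measurable [set t : n.-tuple RM | forall i : 'I_n, `|a i - tnth t i| < r] /\
  lebesgue_tuple n [set t : n.-tuple RM | forall i : 'I_n, `|a i - tnth t i| < r] =
  ((r *+ 2) ^+ n)%:E.
Proof.
move=> r0; elim: n a => [|n IH] a.
  have -> : [set t : 0.-tuple RM | forall i : 'I_0, `|a i - tnth t i| < r] = setT.
    by apply/seteqP; split => // t _ [].
  by split; rewrite //= diracT.
have [mC CE] := IH (fun i => a i.+1).
set C := [set t | _] in mC CE; set B := [set t | _].
have mB : measurable B.
  have -> : B = \bigcap_(i in [set: 'I_n.+1])
      ((fun t : n.+1.-tuple RM => tnth t i) @^-1` ball (a i) r).
    by apply/seteqP; split => t tB i; [move=> _; exact: tB|exact: tB i I].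
  apply: fin_bigcap_measurable => // i _.
  rewrite -[X in measurable X]setTI; apply: measurable_tnth => //.
  exact: measurable_ball.
split => //.
rewrite /= /lebesgue_cons /pushforward.
rewrite (_ : _ @^-1` B = ball (a 0%N) r `*` C); last first.
  apply/seteqP; split => -[x t] /=.
    move=> H; split; first by have := H ord0.
    by move=> i; have := H (lift ord0 i); rewrite tnthS.
  move=> [H1 H2] i; have [j ->|->] := unliftP ord0 i; last exact: H1.
  by rewrite tnthS; exact: H2.
rewrite product_measure1E//; last exact: measurable_ball.
by rewrite CE exprS EFinM; congr (_ * _)%E; exact: lebesgue_measure_ball.
Qed.

Lemma lebesgue_rV_ball n (x : 'rV[R]_n) (r : R) : 0 < r ->
  lebesgue_rV n (ball x r) = ((r *+ 2) ^+ n)%:E.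
Proof.
move=> r0; pose a i := if insub i is Some j then x ord0 j else 0 : R.
have [_ <-] := @lebesgue_tuple_cube n a r (ltW r0).
rewrite /lebesgue_rV /pushforward; congr (lebesgue_tuple n _).
have aE (i : 'I_n) : a i = x ord0 i by rewrite /a valK.
apply/seteqP; split => t /=.
  by move=> [_ H] i; have := H ord0 i; rewrite mxE aE.
by move=> H; split => // i j; rewrite (ord1 i) mxE -aE; exact: H.
Qed.

Lemma open_measurable_rV n (U : set 'rV[R]_n) : open U -> measurable U.
Proof. exact: sub_sigma_algebra. Qed.

Lemma closed_measurable_rV n (U : set 'rV[R]_n) : closed U -> measurable U.
Proof.
move=> cU; rewrite -[U]setCK; apply: measurableC; apply: open_measurable_rV.
exact: closed_openC.
Qed.

Lemma lebesgue_rV_open_gt0 n (U : set 'rV[R]_n) : open U -> U !=set0 ->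
  (0 < lebesgue_rV n U)%E.
Proof.
move=> oU [x Ux].
have /nbhs_ballP[e /= e0 eU] : nbhs x U by exact: open_nbhs_nbhs.
apply: (@lt_le_trans _ _ (lebesgue_rV n (ball x e))).
  by rewrite lebesgue_rV_ball// lte_fin exprn_gt0// mulrn_wgt0.
apply: le_measure; rewrite ?inE//; last exact: open_measurable_rV.
by apply: open_measurable_rV; exact: ball_open.
Qed.

Lemma lebesgue_rV_bounded_lty n (U : set 'rV[R]_n) : measurable U ->
  bounded_set U -> (lebesgue_rV n U < +oo)%E.
Proof.
move=> mU /pinfty_ex_gt0[M M0 UM].
have M1 : 0 < M + 1 by rewrite addr_gt0.
apply: (@le_lt_trans _ _ (lebesgue_rV n (ball (0 : 'rV[R]_n) (M + 1)))).
  apply: le_measure; rewrite ?inE//.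
    by apply: open_measurable_rV; exact: ball_open.
  move=> x Ux; rewrite -ball_normE /ball_ /= sub0r normrN.
  by rewrite (le_lt_trans (UM _ Ux))// ltrDl.
by rewrite lebesgue_rV_ball// ltry.
Qed.

End lebesgue_cubes.

(** * Piecewise constant functions on a mesh *)

Section piecewise_constants.
Context {R : realType} {d : nat} (D : domain R d).
Local Notation mu := (domain_measure D).

Lemma domain_measureE (A : set 'rV[R]_d) : mu A = lebesgue_rV d (A `&` D).
Proof. by []. Qed.

Lemma domain_measure_lty (A : set 'rV[R]_d) : measurable A -> (mu A < +oo)%E.
Proof.
move=> mA; have mD := domain_measurable D.
apply: le_lt_trans (lebesgue_rV_bounded_lty mD (domain_bounded D)).
rewrite domain_measureE; apply: le_measure; rewrite ?inE//.
exact: measurableI.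
Qed.

Section one_mesh.
Context (T : triangulation D).

Lemma measurable_cell (i : 'I_(ncell T)) : measurable (cell i).
Proof. by apply: closed_measurable_rV; exact: cell_closed. Qed.

Lemma measurable_cell_interior (i : 'I_(ncell T)) : measurable (cell i)°.
Proof. by apply: open_measurable_rV; exact: open_interior. Qed.

(** The interior of a cell lies in the closure of [D], so it meets the open set
    [D] in a nonempty open set. *)
Lemma cell_measure_gt0 (i : 'I_(ncell T)) : (0 < mu (cell i))%E.
Proof.
have mDi : measurable ((cell i)° `&` D).
  by apply: measurableI; [exact: measurable_cell_interior|exact: domain_measurable].
apply: (@lt_le_trans _ _ (lebesgue_rV d ((cell i)° `&` D))); last first.
  rewrite domain_measureE; apply: le_measure; rewrite ?inE//.
    by apply: measurableI; [exact: measurable_cell|exact: domain_measurable].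
  by apply: setSI; exact: interior_subset.
apply: lebesgue_rV_open_gt0.
  by apply: openI; [exact: open_interior|exact: domain_open].
have [x xi] := @cell_interior _ _ _ T i.
have xD : closure D x.
  by rewrite -(cell_cover T); exists i => //; exact: interior_subset.
have [y [Dy yi]] := xD _ (open_nbhs_nbhs (conj (@open_interior _ (cell i)) xi)).
by exists y.
Qed.

(** The boundaries of the cells are null, and a point of [D] outside all of them
    that lies in two cells would lie in both interiors. *)
Lemma ae_unique_cell :
  {ae mu, forall x, exists i : 'I_(ncell T), forall j, cell j x <-> j = i}.
Proof.
have aeD : {ae mu, forall x, domain_set D x}.
  exists (~` D); split => //; first by apply: measurableC; exact: domain_measurable.
  by rewrite domain_measureE setICl measure0.
have aeB : {ae mu, forall x, forall i : 'I_(ncell T), ~ (cell i `\` (cell i)°) x}.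
  apply: filter_forall => i; exists (cell i `\` (cell i)°); split.
  - by apply: measurableD; [exact: measurable_cell|exact: measurable_cell_interior].
  - apply/eqP; rewrite eq_le measure_ge0 andbT -(cell_boundary i) domain_measureE.
    apply: le_measure.
    + rewrite inE; apply: measurableI; last exact: domain_measurable.
      by apply: measurableD; [exact: measurable_cell|exact: measurable_cell_interior].
    + rewrite inE.
      by apply: measurableD; [exact: measurable_cell|exact: measurable_cell_interior].
    + exact: subIsetl.
  - by move=> x /= /contrapT.
apply: filterS2 aeD aeB => x Dx Bx.
have : closure D x by exact: subset_closure.
rewrite -(cell_cover T) => -[i _ xi]; exists i => j; split => [xj|->//].
apply: contrapT => /eqP ji.
have int (q : 'I_(ncell T)) : cell q x -> (cell q)° x.
  by move=> xq; apply: contrapT => nx; by case: (Bx q).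
suff : ((cell j)° `&` (cell i)°) x by rewrite cell_disjoint.
by split; exact: int.
Qed.

Variable c : 'I_(ncell T) -> R.
Local Notation W := (mass_matrix c).

Lemma chi_in i x : cell i x -> chi c i x = c i.
Proof. by move=> xi; rewrite /chi indicE mem_set// mulr1. Qed.

Lemma chi_out i x : ~ cell i x -> chi c i x = 0.
Proof. by move=> xi; rewrite /chi indicE memNset// mulr0. Qed.

Lemma chi_Lfun2 i : chi c i \in Lfun mu 2%:E.
Proof.
apply: Lfun2Z; apply: sqr_integrable_Lfun2.
  by apply: measurable_indic; exact: measurable_cell.
rewrite (eq_integral (fun x => (\1_(cell i) x)%:E)); last first.
  by move=> x _; rewrite indicE; case: (_ \in _); rewrite ?expr1n ?expr0n.
rewrite integral_indic//; last exact: measurable_cell.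
by rewrite setIT; apply: domain_measure_lty; exact: measurable_cell.
Qed.

Lemma measurable_chi i : measurable_fun setT (chi c i).
Proof. by have /sub_Lfun_mfun := chi_Lfun2 i; rewrite inE. Qed.

Lemma inner_ae (f g h : 'rV[R]_d -> R) : measurable_fun setT f ->
  measurable_fun setT g -> measurable_fun setT h ->
  {ae mu, forall x, f x = g x} -> inner mu f h = inner mu g h.
Proof.
move=> mf mg mh fg; congr fine; apply: ae_eq_integral => //.
- by apply/measurable_EFinP; exact: measurable_funM.
- by apply/measurable_EFinP; exact: measurable_funM.
- by apply: filterS fg => x -> _.
Qed.

(** By [ae_unique_cell], the product of the basis functions of two distinct
    cells vanishes almost everywhere. *)
Lemma mass_matrix_diag i j : W i j = (c i ^+ 2 * fine (mu (cell i))) *+ (i == j).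
Proof.
rewrite mxE; have [<-|ij] := eqVneq i j.
  rewrite mulr1n -[LHS]/(inner mu (chi c i) (chi c i)) /inner.
  transitivity (\int[mu]_x (c i ^+ 2 * \1_(cell i) x)).
    apply: eq_Rintegral => x _; rewrite /chi indicE.
    by case: (_ \in _); rewrite /=; ring.
  have mi := measurable_cell i.
  have intE : (\int[mu]_x (\1_(cell i) x)%:E = mu (cell i))%E.
    by rewrite integral_indic// setIT.
  rewrite RintegralZl//; first by congr (_ * fine _).
  apply/integrableP; split; first exact/measurable_EFinP/measurable_indic.
  rewrite (eq_integral (fun x => (\1_(cell i) x)%:E)); last first.
    by move=> x _; rewrite /= indicE normr_nat.
  by rewrite intE domain_measure_lty.
rewrite mulr0n -[LHS]/(fine (\int[mu]_x (chi c i x * chi c j x)%:E)%E).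
rewrite (ae_eq_integral (cst 0%E))//.
- by rewrite integral0.
- by apply/measurable_EFinP; apply: measurable_funM; exact: measurable_chi.
- apply: filterS ae_unique_cell => x [q xq] _ /=.
  have [qi|qi] := eqVneq i q; last first.
    by rewrite chi_out ?mul0r// => /xq/eqP; rewrite (negbTE qi).
  rewrite [X in _ * X]chi_out ?mulr0// => /xq jq.
  by move: ij; rewrite qi jq eqxx.
Qed.

Lemma inner_chiB (v w : L2 D) i : inner mu (v - w : L2 D) (chi c i) =
  pairings c v ord0 i - pairings c w ord0 i.
Proof.
rewrite !mxE; apply: (@innerBl _ _ _ mu v w (chi c i)).
- exact: LfunP.
- exact: LfunP.
- exact: chi_Lfun2.
Qed.

Lemma mass_matrix_sym : W^T = W.
Proof. by apply/matrixP => i j; rewrite !mxE; exact: innerC. Qed.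

Lemma mass_matrix_unit : (forall i, c i != 0) -> W \in unitmx.
Proof.
move=> c0.
have -> : W = diag_mx (\row_i (c i ^+ 2 * fine (mu (cell i)))).
  by apply/matrixP => i j; rewrite mass_matrix_diag !mxE.
rewrite unitmxE det_diag unitfE; apply/prodf_neq0 => i _; rewrite mxE.
rewrite mulf_neq0 ?expf_neq0// gt_eqF// fine_gt0// cell_measure_gt0/=.
by apply: domain_measure_lty; exact: measurable_cell.
Qed.

Definition chi_expansion (v : 'rV[R]_d -> R) (a : 'rV[R]_(ncell T)) :=
  {ae mu, forall x, v x = \sum_i a ord0 i * chi c i x}.

Lemma chi_expansion_inner (v w : L2 D) a : chi_expansion v a ->
  inner mu v w = \sum_i a ord0 i * inner mu (chi c i) w.
Proof.
move=> va; rewrite (inner_ae _ _ _ va)//; last first.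
  by apply: measurable_sum => i; apply: measurable_funM => //; exact: measurable_chi.
rewrite inner_suml; last 2 first.
  by move=> i _; apply: Lfun2Z; exact: chi_Lfun2.
  exact: LfunP.
by apply: eq_bigr => i _; rewrite innerZl//; [exact: chi_Lfun2|exact: LfunP].
Qed.

Definition chi_comb (a : 'rV[R]_(ncell T)) : L2 D :=
  Lfun_Sub (lee1n 2) (Lfun2_sum (index_enum _) (fun i (_ : true) =>
    Lfun2Z (a ord0 i) (chi_Lfun2 i))).

Lemma chi_combP a : chi_expansion (chi_comb a) a.
Proof. exact: aeW. Qed.

Lemma chi_expansion_pairings (v : L2 D) a : chi_expansion v a ->
  pairings c v = a *m W.
Proof.
move=> va; apply/rowP => i; rewrite !mxE.
pose ei : L2 D := Lfun_Sub (lee1n 2) (chi_Lfun2 i).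
rewrite -[LHS]/(inner mu v ei) (chi_expansion_inner _ va).
by apply: eq_bigr => j _; rewrite mxE.
Qed.

Lemma chi_expansion_Theta (v : L2 D) a : chi_expansion v a -> Theta T v.
Proof.
move=> va; exists (fun i => a ord0 i * c i) => i.
apply: filterS2 va ae_unique_cell => x -> [j xj] xi.
have {}xj (q : 'I_(ncell T)) : cell q x <-> q = i.
  by rewrite xj; have -> : j = i by apply/esym/xj.
rewrite (bigD1 i)//= big1 => [|q qi].
  by rewrite addr0 chi_in.
rewrite chi_out ?mulr0//.
by move=> /xj/eqP; rewrite (negbTE qi).
Qed.

Lemma chi_expansion_chi i :
  chi_expansion (Lfun_Sub (lee1n 2) (chi_Lfun2 i)) (delta_mx ord0 i).
Proof.
apply: aeW => x /=; rewrite (bigD1 i)//= mxE !eqxx mul1r big1 ?addr0// => j ji.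
by rewrite mxE (negbTE ji) andbF mul0r.
Qed.

Hypothesis c_neq0 : forall i, c i != 0.

Lemma Theta_chi_expansion (v : L2 D) : Theta T v -> exists a, chi_expansion v a.
Proof.
move=> [b vb]; exists (\row_i (b i / c i)).
apply: filterS2 (filter_forall _ vb) ae_unique_cell => x {}vb [i xi].
have xii : cell i x by apply/xi.
rewrite (vb i xii) (bigD1 i)//= big1 => [|q qi].
  by rewrite addr0 chi_in// mxE divfK.
rewrite chi_out ?mulr0//.
by move=> /xi/eqP; rewrite (negbTE qi).
Qed.

(** The mass matrix is invertible, so the pairings determine the
    coordinates. *)
Lemma chi_expansion_unique (v : L2 D) a : chi_expansion v a ->
  a = pairings c v *m invmx W.
Proof.
by move=> /chi_expansion_pairings ->; rewrite mulmxK// mass_matrix_unit.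
Qed.

Lemma coef_vecP (v : L2 D) : Theta T v -> chi_expansion v (coef_vec c v).
Proof.
move=> /Theta_chi_expansion[a va].
by apply: (@xgetPex _ 0 [set a | chi_expansion v a]); exists a.
Qed.

Lemma coef_vecE (v : L2 D) : Theta T v -> coef_vec c v = pairings c v *m invmx W.
Proof. by move=> /coef_vecP/chi_expansion_unique. Qed.

(** The projection is the combination of basis functions whose coordinates are
    the pairings of [v] times the inverse mass matrix. *)
Lemma L2_projP (v : L2 D) : Theta T (L2_proj T v) /\
  forall w, Theta T w -> L2_inner D (v - L2_proj T v : L2 D) w = 0.
Proof.
apply: (@xgetPex _ 0 [set q | Theta T q /\
  forall w, Theta T w -> L2_inner D (v - q : L2 D) w = 0]).
pose a := pairings c v *m invmx W; exists (chi_comb a).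
split=> [|w /Theta_chi_expansion[b wb]].
  exact: chi_expansion_Theta (chi_combP a).
rewrite -[LHS]/(inner mu _ w) innerC (chi_expansion_inner _ wb) big1// => i _.
have := chi_expansion_pairings (chi_combP a).
rewrite /a mulmxKV ?mass_matrix_unit// => /rowP/(_ i).
by rewrite innerC inner_chiB => ->; rewrite subrr mulr0.
Qed.

Lemma pairings_proj (v : L2 D) : pairings c (L2_proj T v) = pairings c v.
Proof.
have [_ orth] := L2_projP v; apply/rowP => i; apply/esym/eqP.
rewrite -subr_eq0 -inner_chiB.
by apply/eqP; exact: orth _ (chi_expansion_Theta (chi_expansion_chi i)).
Qed.

End one_mesh.
End piecewise_constants.

(** * Nested meshes *)

Section two_meshes.
Context {R : realType} {d : nat} (D : domain R d).
Implicit Types S T : triangulation D.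

Lemma Theta_refines S T (v : L2 D) : refines S T -> Theta T v -> Theta S v.
Proof.
move=> /choice[p ST] [b vb]; exists (fun i => b (p i)) => i.
by apply: filterS (vb (p i)) => x vx xi; apply/vx/ST.
Qed.

Lemma ThetaD T (v w : L2 D) : Theta T v -> Theta T w -> Theta T (v + w).
Proof.
move=> [a va] [b wb]; exists (fun i => a i + b i) => i.
by apply: filterS2 (va i) (wb i) => x ax bx xi; rewrite -[LHS]/(v x + w x) ax// bx.
Qed.

Lemma ThetaB T (v w : L2 D) : Theta T v -> Theta T w -> Theta T (v - w).
Proof.
move=> [a va] [b wb]; exists (fun i => a i - b i) => i.
by apply: filterS2 (va i) (wb i) => x ax bx xi; rewrite -[LHS]/(v x - w x) ax// bx.
Qed.

Lemma Theta0 T : Theta T (0 : L2 D).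
Proof. by exists (fun=> 0) => i; exact: aeW. Qed.

Lemma Theta_sum T (m n : nat) (v : nat -> L2 D) :
  (forall l, (m <= l < n)%N -> Theta T (v l)) -> Theta T (\sum_(m <= l < n) v l).
Proof.
move=> Tv; rewrite big_nat_cond; apply: big_ind => [|u w|l /andP[lin _]].
- exact: Theta0.
- exact: ThetaD.
- exact: Tv.
Qed.

Section pairings_linear.
Context T (c : 'I_(ncell T) -> R).

Lemma pairingsB (v w : L2 D) : pairings c (v - w) = pairings c v - pairings c w.
Proof.
apply/rowP => i; have := inner_chiB c v w i; rewrite !mxE => <-.
by [].
Qed.

Lemma pairings0 : pairings c 0 = 0.
Proof. by rewrite -(subrr 0) pairingsB subrr. Qed.

Lemma pairingsD (v w : L2 D) : pairings c (v + w) = pairings c v + pairings c w.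
Proof. by rewrite -[w in LHS]opprK -[- w]sub0r !pairingsB pairings0 sub0r opprK. Qed.

Lemma pairings_sum (m n : nat) (v : nat -> L2 D) :
  pairings c (\sum_(m <= l < n) v l) = \sum_(m <= l < n) pairings c (v l).
Proof. exact: (big_morph _ pairingsD pairings0). Qed.

End pairings_linear.

Definition cross_mass S T (c : 'I_(ncell S) -> R) (e : 'I_(ncell T) -> R) :
    'M[R]_(ncell S, ncell T) :=
  \matrix_(i, j) L2_inner D (chi c i) (chi e j).

Lemma tr_cross_mass S T (c : 'I_(ncell S) -> R) (e : 'I_(ncell T) -> R) :
  (cross_mass c e)^T = cross_mass e c.
Proof. by apply/matrixP => i j; rewrite !mxE; exact: innerC. Qed.

(** Pairings with one mesh are linear in the coordinates on the other. *)
Lemma pairings_cross S T (c : 'I_(ncell S) -> R) (e : 'I_(ncell T) -> R)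
    (v : L2 D) : (forall i, c i != 0) -> Theta S v ->
  pairings e v = pairings c v *m invmx (mass_matrix c) *m cross_mass c e.
Proof.
move=> c0 Sv; have [a va] := Theta_chi_expansion c0 Sv.
rewrite -(chi_expansion_unique c0 va); apply/rowP => j; rewrite !mxE.
pose ej : L2 D := Lfun_Sub (lee1n 2) (chi_Lfun2 e j).
rewrite -[LHS]/(inner _ v ej) (chi_expansion_inner _ va).
by apply: eq_bigr => i _; rewrite mxE.
Qed.

(** The row [i] of [cross_mass e c] lists the pairings of the coarse basis
    function [i] with the fine basis; since that function lies in the fine
    space, [pairings_cross] applies to it. *)
Lemma cross_mass_trans S T U (c : 'I_(ncell S) -> R) (e : 'I_(ncell T) -> R)
    (f : 'I_(ncell U) -> R) : refines S T -> (forall i, c i != 0) ->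
  cross_mass e c *m invmx (mass_matrix c) *m cross_mass c f = cross_mass e f.
Proof.
move=> ST c0; apply/row_matrixP => i; rewrite !row_mul.
pose ei : L2 D := Lfun_Sub (lee1n 2) (chi_Lfun2 e i).
have eiT : Theta T ei.
  exact: chi_expansion_Theta (chi_expansion_chi e i).
have := pairings_cross f c0 (Theta_refines ST eiT).
have rowE V (g : 'I_(ncell V) -> R) : pairings g ei = row i (cross_mass e g).
  by apply/rowP => j; rewrite !mxE.
by rewrite !rowE => <-.
Qed.

End two_meshes.

(** * The multilevel decomposition of white noise *)

Theorem theorem3p1 (R : realType) (d : nat) (hd : d = 2%N \/ d = 3%N)
    (D : domain R d) (k L : nat) (hkL : (k < L)%N)
    (T : nat -> triangulation D)
    (nested : forall l, (l < L)%N -> refines (T l) (T l.+1))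
    (c : forall l, 'I_(ncell (T l)) -> R)
    (c_neq0 : forall l i, (l <= L)%N -> c l i != 0)
    (dO : measure_display) (Omega : measurableType dO)
    (P : probability Omega R)
    (zeta : nat -> Omega -> L2 D)
    (zeta_white : forall l, (k <= l <= L)%N ->
       white_noise_repr P (@c l) (zeta l))
    (zeta_indep : independent_vectors P k L
       (fun l w => coef_vec (@c l) (zeta l w))) :
  let zeta' := fun w =>
    zeta L w + \sum_(k <= l < L) (zeta l w - L2_proj (T l.+1) (zeta l w)) in
  white_noise_repr P (@c k) zeta' /\
  has_normal_law P (fun w => coef_vec (@c k) (zeta' w)) 0 (invmx (mass_matrix (@c k))).
Proof.
move=> zeta'.
have c0 l : (l <= L)%N -> forall i, c l i != 0 by move=> lL i; exact: c_neq0.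
pose W l := mass_matrix (c l); pose M l q := cross_mass (c l) (c q).
have Wu l : (l <= L)%N -> W l \in unitmx by move=> lL; exact/mass_matrix_unit/c0.
have Wsym l : (invmx (W l))^T = invmx (W l) by rewrite trmx_inv mass_matrix_sym.
have MT l q : (M l q)^T = M q l by exact: tr_cross_mass.
have Mtrans l q : (l < L)%N -> M l.+1 l *m invmx (W l) *m M l q = M l.+1 q.
  by move=> lL; exact: cross_mass_trans (nested l lL) (c0 l (ltnW lL)).
have Mtrans' l q : (l < L)%N -> M q l *m invmx (W l) *m M l l.+1 = M q l.+1.
  move=> lL; apply: trmx_inj; rewrite !trmx_mul Wsym !MT mulmxA.
  exact: Mtrans.
have nestedk l (v : L2 D) : (k <= l <= L)%N -> Theta (T l) v -> Theta (T k) v.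
  move=> /andP[]; elim: l v => [|l IH] v.
    by rewrite leqn0 => /eqP ->.
  rewrite leq_eqVlt => /predU1P[<-//|kl lL Tv].
  by apply: IH => //; [exact: ltnW|exact: Theta_refines (nested l lL) Tv].
have Tzeta l w : (k <= l <= L)%N -> Theta (T l) (zeta l w).
  by move=> /zeta_white[].
have Tproj l v : (l <= L)%N -> Theta (T l) (L2_proj (T l) v).
  by move=> lL; have [] := L2_projP (c0 l lL) v.
have kLL : (k <= L <= L)%N by rewrite ltnW/=.
have Tzeta' w : Theta (T k) (zeta' w).
  apply: ThetaD; first exact: nestedk kLL (Tzeta L w kLL).
  apply: Theta_sum => l /andP[kl lL].
  have lin : (k <= l <= L)%N by rewrite kl ltnW.
  apply: ThetaB; first exact: nestedk lin (Tzeta l w lin).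
  apply: (@nestedk l.+1); last exact: Tproj.
  by rewrite lL (leq_trans kl).
have coefE l w : (k <= l <= L)%N ->
    coef_vec (c l) (zeta l w) = pairings (c l) (zeta l w) *m invmx (W l).
  move=> /[dup] lin /andP[_ lL]; rewrite coef_vecE//; [exact: c0|exact: Tzeta].
(* The top level is not projected, hence the case distinction. *)
pose A l : 'M[R]_(ncell (T l), ncell (T k)) :=
  M l k - (if (l < L)%N then M l l.+1 *m invmx (W l.+1) *m M l.+1 k else 0).
have pairE w : pairings (c k) (zeta' w) =
    \sum_(k <= l < L.+1) coef_vec (c l) (zeta l w) *m A l.
  rewrite big_nat_recr ?(ltnW hkL)//= pairingsD pairings_sum [LHS]addrC.
  congr (_ + _); last first.
    rewrite /A ltnn subr0 coefE//; apply: pairings_cross; first exact: c0.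
    exact: Tzeta.
  apply: eq_big_nat => l /andP[kl lL].
  have lin : (k <= l <= L)%N by rewrite kl ltnW.
  rewrite pairingsB /A lL mulmxBr coefE//; congr (_ - _).
    by apply: pairings_cross; [exact/c0/ltnW|exact: Tzeta].
  rewrite (pairings_cross _ (c0 l.+1 lL)); last exact: Tproj.
  rewrite (pairings_proj (c0 l.+1 lL)) !mulmxA; congr (_ *m _ *m _).
  by apply: pairings_cross; [exact/c0/ltnW|exact: Tzeta].
pose G l := M k l *m invmx (W l) *m M l k.
(* Galerkin identity: projecting and then prolonging a level-l field removes
   exactly the level-(l+1) part of the covariance. *)
have covE l : (l < L)%N -> (A l)^T *m invmx (W l) *m A l = G l - G l.+1.
  move=> lL.
  have AT : (A l)^T = M k l - M k l.+1 *m invmx (W l.+1) *m M l.+1 l.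
    by rewrite /A lL linearB /= !trmx_mul !MT Wsym mulmxA.
  rewrite AT !mulmxBl /A lL !mulmxBr !mulmxA Mtrans'//.
  have XE q : M k l.+1 *m invmx (W l.+1) *m M l.+1 l *m invmx (W l) *m M l q =
      M k l.+1 *m invmx (W l.+1) *m M l.+1 q.
    by rewrite -!mulmxA (mulmxA (M l.+1 l)) Mtrans.
  rewrite !XE; have -> : M l.+1 l.+1 = W l.+1 by [].
  by rewrite mulmxKV ?Wu// subrr subr0.
have covL : (A L)^T *m invmx (W L) *m A L = G L.
  by rewrite /A ltnn subr0 MT.
have Gk : G k = W k.
  have Mk : M k k = W k by [].
  by rewrite /G Mk mulmxKV ?Wu// ltnW.
have coef_law l : (k <= l <= L)%N ->
    has_normal_law P (fun w => coef_vec (c l) (zeta l w)) 0 (invmx (W l)).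
  move=> /[dup] lin /andP[_ lL].
  under eq_fun do rewrite coefE//.
  have [_ /has_normal_law_mulmx] := zeta_white l lin.
  by move=> /(_ _ (invmx (W l))); rewrite Wsym mulVmx ?Wu// mul1mx.
have pair_law : has_normal_law P (fun w => pairings (c k) (zeta' w)) 0 (W k).
  under eq_fun do rewrite pairE.
  have := has_normal_law_sum_mulmx A coef_law zeta_indep.
  rewrite big_nat_recr ?(ltnW hkL)//= covL.
  rewrite (eq_big_nat _ _ (F2 := fun l => G l - G l.+1)); last first.
    by move=> l /andP[_ lL]; exact: covE.
  rewrite -[X in X + _]opprK -sumrN.
  rewrite (eq_bigr (fun l => G l.+1 - G l)); last by move=> l _; rewrite opprB.
  by rewrite telescope_sumr ?(ltnW hkL)// opprB subrK Gk.
split; first by split.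
have -> : (fun w => coef_vec (c k) (zeta' w)) =
    (fun w => pairings (c k) (zeta' w) *m invmx (W k)).
  by apply/funext => w; apply: coef_vecE; [exact/c0/ltnW|exact: Tzeta'].
have := has_normal_law_mulmx (invmx (W k)) pair_law.
rewrite Wsym mulVmx ?mul1mx//.
by apply: Wu; exact: ltnW.
Qed.
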